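(* Let $\mathcal{A}=(\Sigma,Q,F,\Delta)$ be a $T$-shaped tree automaton. A vector $\mu$ over $\mathrm{var}(\mathcal{A})$ belongs to $P_{ex}(\mathcal{A})$ if and only if $\mu$ satisfies all constraints of the system $\mathfrak{L}_{\mathcal{A}}$.
   Context: An addressed tree $T$ is a rooted tree with node set $N(T)$, root $r$, children of each node numbered $1,\dots,s$; $\mathrm{par}(u)$ denotes the parent of $u\ne r$. $\Sigma$ is a finite alphabet; a $T$-shaped term is a map $\tau:N(T)\to\Sigma$. A $T$-shaped tree automaton $\mathcal{A}=(\Sigma,Q,F,\Delta)$ has states $Q$ partitioned into cells $\{Q_u\}_{u\in N(T)}$, final states $F\subseteq Q_r$, and transitions $\Delta$ partitioned into $\{\Delta_u\}$ with $\Delta_u\subseteq Q_{u_1}\times\dots\times Q_{u_s}\times\Sigma\times Q_u$ ($u_1,\dots,u_s$ the children of $u$ in order). A trace for $\tau$ is $\rho:N(T)\to Q$ with $(\rho(u_1),\dots,\rho(u_s),\tau(u),\rho(u))\in\Delta_u$ for every $u$; it is accepting if $\rho(r)\in F$; $\mathcal{L}(\mathcal{A})$ is the set of terms with an accepting trace. For $\delta=(q_1,\dots,q_s,a,q)$ let $\mathrm{cnq}(\delta)=q$, $\mathrm{ant}(\delta)=\{q_1,\dots,q_s\}$, $\mathrm{symb}(\delta)=a$. Variables: $\mathrm{var}(\mathcal{A})$ consists of $x_{u,a}$ ($u\in N(T)$, $a\in\Sigma$), $y_{u,q}$ ($u\in N(T)$, $q\in Q_u$), $z_{u,\delta}$ ($u\in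 N(T)$, $\delta\in\Delta_u$). The system $\mathfrak{L}_{\mathcal{A}}$ consists of: (i) $0\le x_{u,a}\le1$, $0\le y_{u,q}\le1$, $0\le z_{u,\delta}\le1$ for all variables; (ii) $\sum_{q\in F}y_{r,q}=1$; (iii) $y_{r,q}=0$ for all $q\in Q_r\setminus F$; (iv) for all $u$ and $q\in Q_u$: $\sum_{\delta\in\Delta_u,\mathrm{cnq}(\delta)=q}z_{u,\delta}=y_{u,q}$; (v) for all $u\ne r$ and $q\in Q_u$: $\sum_{\delta\in\Delta_{\mathrm{par}(u)},q\in\mathrm{ant}(\delta)}z_{\mathrm{par}(u),\delta}=y_{u,q}$; (vi) for all $u$ and $a\in\Sigma$: $\sum_{\delta\in\Delta_u,\mathrm{symb}(\delta)=a}z_{u,\delta}=x_{u,a}$. For a term $\tau$ and a trace $\rho$ for $\tau$, $\hat\rho$ is the 0/1 vector over $\mathrm{var}(\mathcal{A})$ with $\hat\rho(x_{u,a})=1$ iff $\tau(u)=a$; $\hat\rho(y_{u,q})=1$ iff $\rho(u)=q$; $\hat\rho(z_{u,\delta})=1$ iff $\delta=(\rho(u_1),\dots,\rho(u_s),\tau(u),\rho(u))$ where $u_1,\dots,u_s$ are the children of $u$. $P_{ex}(\mathcal{A})=\mathrm{conv}\{\hat\rho:\rho\text{ an accepting trace (of some term) in }\mathcal{A}\}$. *)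

(* Defs.v *)
From HB Require Import structures.
From mathcomp Require Import all_boot all_order all_algebra.
From mathcomp Require Import reals.

Set Implicit Arguments.
Unset Strict Implicit.
Unset Printing Implicit Defensive.

Local Open Scope ring_scope.

Record addressed_tree := AddressedTree {
  node :> finType;
  root : node;
  arity : node -> nat;
  child : forall u : node, 'I_(arity u) -> node;
  child_inj : forall u, injective (child (u := u));
  child_neq_root : forall u (i : 'I_(arity u)), child i <> root;
  parent_unique : forall u v (i : 'I_(arity u)) (j : 'I_(arity v)),
    child i = child j -> u = v;
  root_connect : forall u,
    connect [rel v w | [exists i : 'I_(arity v), child i == w]] root u
}.

Arguments root {_}.
Arguments arity {_} _.
Arguments child {_ _} _.

(* The value at the root, which has no parent, is a dummy. *)
Definition par (T : addressed_tree) (u : T) : T :=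
  odflt u [pick v : T | [exists i : 'I_(arity v), child i == u]].

(* The type of tuples (q_1, ..., q_s, a, q), with s the arity of u. *)
Definition transition (T : addressed_tree) (Sigma Q : finType) (u : T) : finType :=
  ((arity u).-tuple Q * Sigma * Q)%type.

Section Transition.
Variables (T : addressed_tree) (Sigma Q : finType) (u : T).
Implicit Type d : transition Sigma Q u.

Definition cnq d : Q := d.2.
Definition ant d : {set Q} := [set q in d.1.1].
Definition symb d : Sigma := d.1.2.
End Transition.

(* [cell] encodes the partition of the states: Q_u is the fibre of [cell] at u,
   possibly empty. The sets Delta_u are pairwise disjoint by [delta_cell]. *)
Record tree_automaton (T : addressed_tree) (Sigma : finType) := TreeAutomaton {
  state : finType;
  cell : state -> T;
  final : {set state};
  delta : forall u : T, {set transition Sigma state u};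
  final_root : forall q, q \in final -> cell q = root;
  delta_cell : forall (u : T) (d : transition Sigma state u), d \in delta u ->
    (forall i : 'I_(arity u), cell (tnth d.1.1 i) = child i) /\ cell d.2 = u
}.

Section Automaton.
Variables (R : realType) (T : addressed_tree) (Sigma : finType).
Variable A : tree_automaton T Sigma.

Definition cell_at (u : T) : {set state A} := [set q | cell q == u].

Definition state_at (u : T) : finType := {q : state A | q \in cell_at u}.

Definition delta_at (u : T) : finType :=
  {d : transition Sigma (state A) u | d \in delta A u}.

Definition trans_of (tau : T -> Sigma) (rho : T -> state A) (u : T) :
    transition Sigma (state A) u :=
  ([tuple rho (child i) | i < arity u], tau u, rho u).

Definition is_trace (tau : T -> Sigma) (rho : T -> state A) : Prop :=
  forall u, trans_of tau rho u \in delta A u.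

Definition accepting_trace (tau : T -> Sigma) (rho : T -> state A) : Prop :=
  is_trace tau rho /\ rho root \in final A.

Inductive var : Type :=
| X (u : T) (a : Sigma)
| Y (u : T) (q : state_at u)
| Z (u : T) (d : delta_at u).

Definition hat (tau : T -> Sigma) (rho : T -> state A) (v : var) : R :=
  match v with
  | X u a => (tau u == a)%:R
  | Y u q => (rho u == val q)%:R
  | Z u d => (val d == trans_of tau rho u)%:R
  end.

Record satisfies_system (mu : var -> R) : Prop := SatisfiesSystem {
  var_bounds : forall v, 0 <= mu v <= 1;
  final_sum : \sum_(q : state_at root | val q \in final A) mu (Y q) = 1;
  nonfinal_eq0 : forall q : state_at root, val q \notin final A -> mu (Y q) = 0;
  cnq_sum : forall (u : T) (q : state_at u),
    \sum_(d : delta_at u | cnq (val d) == val q) mu (Z d) = mu (Y q);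
  ant_sum : forall u : T, u <> root -> forall q : state_at u,
    \sum_(d : delta_at (par u) | val q \in ant (val d)) mu (Z d) = mu (Y q);
  symb_sum : forall (u : T) (a : Sigma),
    \sum_(d : delta_at u | symb (val d) == a) mu (Z d) = mu (X u a)
}.

End Automaton.

Definition conv (R : realType) (I : Type) (S : (I -> R) -> Prop) (x : I -> R) :
    Prop :=
  exists (n : nat) (p : 'I_n -> I -> R) (w : 'I_n -> R),
    [/\ forall k, S (p k), forall k, 0 <= w k, \sum_k w k = 1
      & forall i, x i = \sum_k w k * p k i].

Definition P_ex (R : realType) (T : addressed_tree) (Sigma : finType)
    (A : tree_automaton T Sigma) : (var A -> R) -> Prop :=
  conv (fun x => exists (tau : T -> Sigma) (rho : T -> state A),
    accepting_trace tau rho /\ x = hat R tau rho).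

(* Main.v *)
(** An accepting trace is a unit flow from the root to the leaves, and the
    equations of the system say that [mu] is a flow of some value [c].  Starting
    from a final state with positive [Y]-value, each state of positive value is
    the consequent of a transition of positive [Z]-value, whose antecedents have
    positive value again; this yields an accepting trace supported by [mu].
    Subtracting the largest admissible multiple of it kills a [Z]-value while
    keeping a nonnegative flow, so induction on the number of nonzero
    [Z]-values writes [mu] as a nonnegative combination of accepting traces. *)
Require Import Defs.
From mathcomp Require Import all_boot all_order all_algebra.
From mathcomp Require Import reals.
(* [poly] shadows [root]. *)
Import Defs.

Set Implicit Arguments.
Unset Strict Implicit.
Unset Printing Implicit Defensive.

Import Order.TTheory GRing.Theory Num.Theory.
Local Open Scope ring_scope.

(** * Induction and recursion from the root downwards *)

Section Tree.
Variable T : addressed_tree.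

Lemma tree_ind (P : T -> Prop) :
  P root -> (forall u (i : 'I_(arity u)), P u -> P (child i)) -> forall u, P u.
Proof.
move=> P0 PS u; have /connectP[p pth ->] := root_connect u.
elim/last_ind: p pth => [|p v IH] //=.
rewrite rcons_path last_rcons => /andP[/IH Pp /existsP[i /eqP <-]].
exact: PS.
Qed.

Lemma child_of_neq_root (u : T) :
  u <> root -> exists v (i : 'I_(arity v)), u = child i.
Proof. by elim/tree_ind: u => [//|v i _ _]; exists v, i. Qed.

Lemma par_child (u : T) (i : 'I_(arity u)) : par (child i) = u.
Proof.
rewrite /par; case: pickP => [v /existsP[j /eqP]|/(_ u)] /=.
  exact: parent_unique.
by move/existsP; case; exists i.
Qed.

(** Each non-root node is reached by exactly one edge, so its value can be computed from that of its
    parent. The recursion runs on fuel, and finiteness of the tree gives an amount of fuel that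
    suffices everywhere. *)
Lemma tree_rec_exists (S : Type) (x0 : S)
    (step : forall u : T, 'I_(arity u) -> S -> S) :
  exists f : T -> S, f root = x0 /\
    forall u (i : 'I_(arity u)), f (child i) = step u i (f u).
Proof.
pose parent_index (u : T) :=
  [pick vi : {v : T & 'I_(arity v)} | child (tagged vi) == u].
(* Running out of fuel yields [x0], the correct value at the root for every [n]. *)
pose fix F n u {struct n} := if n is n'.+1 then
  if parent_index u is Some vi then step _ (tagged vi) (F n' (tag vi)) else x0
  else x0.
have F0 n : F n root = x0.
  case: n => //= n; rewrite /parent_index; case: pickP => //= vi /eqP.
  by move/child_neq_root.
have FS n u (i : 'I_(arity u)) : F n.+1 (child i) = step u i (F n u).
  rewrite /= /parent_index; case: pickP => [[v j] /= /eqP|/(_ (Tagged _ i))] /=.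
    move=> e; have ? := parent_unique e; subst v.
    by rewrite (child_inj e).
  by rewrite eqxx.
have /fin_all_exists[m Fm] u : exists m, forall n, (m <= n)%N -> F n u = F m u.
  elim/tree_ind: u => [|u i [m Fm]]; first by exists 0%N => n _; rewrite !F0.
  by exists m.+1 => -[//|n] mn; rewrite !FS Fm.
pose M := \max_u m u.
exists (F M); split=> [|u i]; first exact: F0.
have le_mM v : (m v <= M)%N by exact: (leq_bigmax v).
(* Unfolding at [child i] costs one unit of fuel; beyond [m] that extra unit changes nothing. *)
by rewrite -FS Fm // -(Fm _ M.+1) // leqW.
Qed.

End Tree.

Lemma sum_sig_indicator (R : pzRingType) (I : finType) (P B : pred I) (a : I) :
  P a -> \sum_(x : {x | P x} | B (val x)) (a == val x)%:R = (B a)%:R :> R.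
Proof.
move=> Pa; rewrite big_mkcond (bigD1 (exist P a Pa)) //= eqxx big1 ?addr0.
  by case: (B a).
move=> x; rewrite -val_eqE /= eq_sym => /negPf ->.
by case: ifP.
Qed.

Lemma sum_gt0_exists (R : realDomainType) (I : finType) (P : pred I) (F : I -> R) :
  0 < \sum_(i | P i) F i -> exists2 i, P i & 0 < F i.
Proof.
move=> F_gt0; case: (pickP (fun i => P i && (0 < F i))) => [i /andP[]|noF].
  by exists i.
move: F_gt0; rewrite ltNge sumr_le0 // => i Pi.
by have := noF i; rewrite Pi /= leNgt => ->.
Qed.

(** * Flows and their decomposition into accepting traces *)

Section Flow.
Variables (R : realType) (T : addressed_tree) (Sigma : finType).
Variable A : tree_automaton T Sigma.
Implicit Types (mu : var A -> R) (c : R).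

(* The equality constraints of the system, with the total mass relaxed from 1 to
   [c] and the constraint on [u <> root] indexed by the edge entering [u]. *)
Record flow c mu : Prop := Flow {
  flow_final : \sum_(q : state_at A root | val q \in final A) mu (Y q) = c;
  flow_nonfinal : forall q : state_at A root, val q \notin final A -> mu (Y q) = 0;
  flow_cnq : forall (u : T) (q : state_at A u),
    \sum_(d : delta_at A u | cnq (val d) == val q) mu (Z d) = mu (Y q);
  flow_ant : forall (u : T) (i : 'I_(arity u)) (q : state_at A (child i)),
    \sum_(d : delta_at A u | val q \in ant (val d)) mu (Z d) = mu (Y q);
  flow_symb : forall (u : T) (a : Sigma),
    \sum_(d : delta_at A u | symb (val d) == a) mu (Z d) = mu (X A u a)
}.

Lemma satisfies_systemE mu :
  satisfies_system mu <-> (forall v, 0 <= mu v <= 1) /\ flow 1 mu.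
Proof.
split=> [[bnd fin nfin cnqs ants symbs]|[bnd [fin nfin cnqs ants symbs]]].
  split=> //; split=> // u i q.
  by have := ants _ (@child_neq_root T u i) q; rewrite par_child.
split=> // u /child_of_neq_root[v [i ->]] q.
by rewrite par_child ants.
Qed.

Lemma flow_lincomb n (c : 'I_n -> R) (p : 'I_n -> var A -> R) (w : 'I_n -> R) mu :
  (forall k, flow (c k) (p k)) -> (forall v, mu v = \sum_k w k * p k v) ->
  flow (\sum_k w k * c k) mu.
Proof.
move=> fp muE.
have sumE (I : finType) (P : pred I) (V : I -> var A) :
    \sum_(i | P i) mu (V i) = \sum_k w k * \sum_(i | P i) p k (V i).
  under eq_bigr do rewrite muE.
  by rewrite exchange_big; apply: eq_bigr => k _; rewrite mulr_sumr.
split=> [|q qN|u q|u i q|u a]; rewrite ?sumE ?muE.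
- by apply: eq_bigr => k _; rewrite (flow_final (fp k)).
- by apply: big1 => k _; rewrite (flow_nonfinal (fp k)) // mulr0.
- by apply: eq_bigr => k _; rewrite (flow_cnq (fp k)).
- by apply: eq_bigr => k _; rewrite (flow_ant (fp k)).
- by apply: eq_bigr => k _; rewrite (flow_symb (fp k)).
Qed.

Lemma flow_subZ c c' e mu nu :
  flow c mu -> flow c' nu -> flow (c - e * c') (fun v => mu v - e * nu v).
Proof.
move=> fm fn; split=> [|q qN|u q|u i q|u a]; rewrite ?sumrB -?mulr_sumr.
- by rewrite (flow_final fm) (flow_final fn).
- by rewrite (flow_nonfinal fm) // (flow_nonfinal fn) // mulr0 subr0.
- by rewrite (flow_cnq fm) (flow_cnq fn).
- by rewrite (flow_ant fm) (flow_ant fn).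
- by rewrite (flow_symb fm) (flow_symb fn).
Qed.

(** The [X] and [Y] values are sums of [Z] values. *)
Lemma flow_ge0 c mu : flow c mu ->
  (forall u (d : delta_at A u), 0 <= mu (Z d)) -> forall v, 0 <= mu v.
Proof.
move=> fm Z0 [u a|u q|//]; first by rewrite -(flow_symb fm) sumr_ge0.
by rewrite -(flow_cnq fm) sumr_ge0.
Qed.

Lemma delta_at_cell (u : T) (d : delta_at A u) : cnq (val d) \in cell_at A u.
Proof. by rewrite inE; have [_ ->] := delta_cell (valP d). Qed.

Lemma delta_at_cell_child (u : T) (d : delta_at A u) (i : 'I_(arity u)) :
  tnth (val d).1.1 i \in cell_at A (child i).
Proof. by rewrite inE; have [->] := delta_cell (valP d). Qed.

Lemma trace_cell tau (rho : T -> state A) u :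
  is_trace tau rho -> rho u \in cell_at A u.
Proof. by move=> tr; rewrite inE; have [_ /= ->] := delta_cell (tr u). Qed.

Lemma hat_flow tau (rho : T -> state A) :
  accepting_trace tau rho -> flow 1 (hat R tau rho).
Proof.
move=> [tr acc].
have sumZ u (B : pred (transition Sigma (state A) u)) :
    \sum_(d : delta_at A u | B (val d)) hat R tau rho (Z d) =
    (B (trans_of tau rho u))%:R.
  under eq_bigr do rewrite /= eq_sym.
  exact: (@sum_sig_indicator _ _ (fun d => d \in delta A u) B _ (tr u)).
split=> [|q qN|u q|u i q|u a] /=.
- rewrite (@sum_sig_indicator _ _ (fun q => q \in cell_at A root)
            (fun q => q \in final A)) ?acc //.
  exact: trace_cell tr.
- by case: eqP => // rhoE; rewrite -[val q]rhoE acc in qN.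
- exact: (sumZ u (fun d => cnq d == val q)).
- rewrite (sumZ u (fun d => val q \in ant d)); congr (_%:R); congr nat_of_bool.
  (* Cells are disjoint and [child] is injective, so a state in the cell of [child i] can occur as
     an antecedent only at position [i]. *)
  rewrite inE /=; apply/mapP/eqP => [[j _ qE]|<-].
    have := valP q; rewrite [val q]qE; have := trace_cell (child j) tr.
    by rewrite [RHS]qE !inE => /eqP-> /eqP/child_inj ->.
  by exists i; rewrite ?mem_enum.
- exact: (sumZ u (fun d => symb d == a)).
Qed.

(** Vanishing spreads downwards: zero [Y] values at a node force zero [Z] values there, hence zero
    [Y] values at its children. *)
Lemma flow0_eq0 mu : flow 0 mu -> (forall v, 0 <= mu v) -> forall v, mu v = 0.
Proof.
move=> fm m0.
have Zcnq u : (forall q : state_at A u, mu (Y q) = 0) ->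
    forall d : delta_at A u, mu (Z d) = 0.
  move=> Y0 d.
  have := flow_cnq fm (exist (fun q => q \in cell_at A u) _ (delta_at_cell d)).
  by rewrite Y0 => /(psumr_eq0P (fun _ _ => m0 _)) -> //=.
have Y0 u : forall q : state_at A u, mu (Y q) = 0.
  elim/tree_ind: u => [|u i Yu] q.
    have [qF|/(flow_nonfinal fm)//] := boolP (val q \in final A).
    exact: (psumr_eq0P (fun _ _ => m0 _) (flow_final fm)).
  by rewrite -(flow_ant fm) big1 // => d _; exact: Zcnq.
have Z0 u (d : delta_at A u) : mu (Z d) = 0 by exact: Zcnq (Y0 u) d.
by case=> [u a|u q|u d] //; rewrite -(flow_symb fm) big1.
Qed.

Lemma flow_trace_exists c mu :
  flow c mu -> (forall v, 0 <= mu v) -> 0 < c ->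
  exists tau (rho : T -> state A) (d : forall u, delta_at A u),
    [/\ accepting_trace tau rho, forall u, val (d u) = trans_of tau rho u
      & forall u, 0 < mu (Z (d u))].
Proof.
move=> fm m0 c_gt0.
have [q0 q0F q0_gt0] : exists2 q : state_at A root,
    val q \in final A & 0 < mu (Y q).
  by apply: sum_gt0_exists; rewrite (flow_final fm).
pose next u (q : state A) :=
  [pick d : delta_at A u | (cnq (val d) == q) && (0 < mu (Z d))].
(* The default [q] is never taken along [rho]: [rho_pos] keeps its states at positive value, where
   [next] succeeds. *)
pose step u (i : 'I_(arity u)) q :=
  if next u q is Some d then tnth (val d).1.1 i else q.
have [rho [rho0 rhoS]] := tree_rec_exists (val q0) step.
pose pos u (q : state A) := exists2 q' : state_at A u, val q' = q & 0 < mu (Y q').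
have nextP u : pos u (rho u) -> exists d : delta_at A u,
    [/\ cnq (val d) = rho u, 0 < mu (Z d)
      & forall i, tnth (val d).1.1 i = rho (child i)].
  case=> q qE; rewrite -(flow_cnq fm) qE => /sum_gt0_exists[d dq d_gt0].
  case E: (next u (rho u)) => [d'|]; last first.
    by move: E; rewrite /next; case: pickP => // /(_ d); rewrite dq d_gt0.
  exists d'; split; [| |by move=> i; rewrite rhoS /step E];
    by move: E; rewrite /next; case: pickP => // ? /andP[/eqP ? ?] [<-].
have rho_pos u : pos u (rho u).
  elim/tree_ind: u => [|u i /nextP[d [_ d_gt0 dE]]]; first by exists q0.
  exists (exist (fun q => q \in cell_at A (child i)) _ (delta_at_cell_child d i));
    first exact: dE.
  (* The chosen [d] has the new state among its antecedents and contributes a positive term. *)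
  rewrite -(flow_ant fm) (bigD1 d) /=; last by rewrite inE mem_tnth.
  by rewrite ltr_pwDl // sumr_ge0.
have /fin_all_exists[d dP] u := nextP u (rho_pos u).
pose tau u := symb (val (d u)).
have dE u : val (d u) = trans_of tau rho u.
  have [dq _ dS] := dP u; rewrite /trans_of -dq /tau.
  case: (val (d u)) dS => [[s a] q] /= dS.
  by congr (_, _, _); apply: eq_from_tnth => i; rewrite tnth_mktuple dS.
exists tau, rho, d; split=> [|//|u]; last by have [] := dP u.
by split=> [u|]; rewrite ?rho0 // -dE (valP (d u)).
Qed.

Lemma flow_decompose c mu : flow c mu -> (forall v, 0 <= mu v) ->
  exists n (p : 'I_n -> var A -> R) (w : 'I_n -> R),
    [/\ forall k, exists tau rho, accepting_trace tau rho /\ p k = hat R tau rho,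
        forall k, 0 <= w k, \sum_k w k = c
      & forall v, mu v = \sum_k w k * p k v].
Proof.
pose supp mu := [set ud : {u : T & delta_at A u} | mu (Z (tagged ud)) != 0].
have [m] := ubnP #|supp mu|; elim: m => // m IH in c mu * => supp_m fm m0.
have c_ge0 : 0 <= c by rewrite -(flow_final fm) sumr_ge0.
have [c_gt0|] := ltP 0 c; last first.
  move=> c_le0; have c0 : c = 0 by apply/eqP; rewrite eq_le c_le0.
  rewrite c0 in fm *.
  (* Mass zero: the empty combination. *)
  exists 0%N, (fun _ _ => 0), (fun _ => 0); split=> [[]//|[]//||v].
    by rewrite big_ord0.
  by rewrite big_ord0 flow0_eq0.
have [tau [rho [d [acc dE d_gt0]]]] := flow_trace_exists fm m0 c_gt0.
(* The bottleneck of the trace gives the largest multiple [e] that can be subtracted. *)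
pose u0 := [arg min_(u < root) mu (Z (d u))]%O.
have u0_min u : mu (Z (d u0)) <= mu (Z (d u)).
  by rewrite /u0; case: arg_minP => // v _; apply.
set e := mu (Z (d u0)) in u0_min.
pose nu v := mu v - e * hat R tau rho v.
have hatZ u (d' : delta_at A u) : hat R tau rho (Z d') = (d' == d u)%:R.
  by rewrite /= -dE val_eqE.
have fn : flow (c - e) nu.
  by have := flow_subZ e fm (hat_flow acc); rewrite mulr1.
have nu_ge0 : forall v, 0 <= nu v.
  apply: (flow_ge0 fn) => u d'; rewrite /nu hatZ.
  by case: eqP => [->|_]; rewrite ?mulr1 ?mulr0 ?subr0 ?subr_ge0.
have supp_lt : (#|supp nu| < m)%N.
  (* No zero [Z] value becomes nonzero, since the trace uses only positive ones, and the one at [u0]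
     drops to zero. *)
  rewrite -ltnS; apply: leq_trans supp_m; apply/proper_card/properP; split.
    apply/subsetP=> -[u d']; rewrite !inE /nu hatZ /=; apply: contraNN => /eqP d'0.
    have /negPf-> : d' != d u.
      by apply/eqP => d'E; have := d_gt0 u; rewrite -d'E d'0 ltxx.
    by rewrite mulr0 subr0 d'0.
  exists (Tagged (fun u => delta_at A u) (d u0)); rewrite !inE /=; first by rewrite gt_eqF.
  by rewrite /nu hatZ eqxx mulr1 subrr eqxx.
have [n [p [w [pP w_ge0 w_sum nuE]]]] := IH _ _ supp_lt fn nu_ge0.
(* The extracted trace takes index 0 with weight [e]; the decomposition of [nu] is shifted by
   one. *)
exists n.+1, (fun k => oapp p (hat R tau rho) (unlift ord0 k)),
  (fun k => oapp w e (unlift ord0 k)); split=> [k|k||v].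
- by case: unliftP => [j|] _ /=; [exact: pP|exists tau, rho].
- by case: unliftP => [j|] _ /=; [exact: w_ge0|exact: ltW (d_gt0 u0)].
- rewrite big_ord_recl unlift_none /=.
  by under eq_bigr do rewrite liftK /=; rewrite w_sum subrKC.
- rewrite big_ord_recl unlift_none /=.
  by under eq_bigr do rewrite liftK /=; rewrite -nuE subrKC.
Qed.

End Flow.

Theorem theorem4p4 (R : realType) (T : addressed_tree) (Sigma : finType)
    (A : tree_automaton T Sigma) (mu : var A -> R) :
  P_ex mu <-> satisfies_system mu.
Proof.
split=> [[n [p [w [pP w_ge0 w_sum muE]]]]|/satisfies_systemE[bnd fm]]; last first.
  by apply: (flow_decompose fm) => v; have /andP[] := bnd v.
have p01 k v : 0 <= p k v <= 1.
  have [tau [rho [_ ->]]] := pP k.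
  by case: v => [u a|u q|u d] /=; rewrite ler0n lern1 leq_b1.
have fp k : flow 1 (p k).
  by have [tau [rho [/(hat_flow R) ? ->]]] := pP k.
apply/satisfies_systemE; split=> [v|].
  rewrite muE sumr_ge0 /=; last first.
    by move=> k _; rewrite mulr_ge0 //; have /andP[] := p01 k v.
  (* Writing the bound 1 as the sum of the weights allows a termwise comparison. *)
  rewrite -w_sum ler_sum // => k _; rewrite ler_piMr //.
  by have /andP[] := p01 k v.
have := flow_lincomb fp muE; under eq_bigr do rewrite mulr1.
by rewrite w_sum.
Qed.
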